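(* Let $I=(G=(V,E),\mathcal{C},\omega,\ell,b)$ be an instance of \textsc{Stars NWS} and $E^*\subseteq E$. For each community $C\in\mathcal{C}$ with $|\mathfrak{C}(C)|\ge 2$ and each minimum solution $G'$ that is fitting for $E^*$, there is a vertex $v\in\bigcap_{\widetilde C\in\mathfrak{C}(C)}\widetilde C$ such that $\mathrm{univ}_{G'}(\widetilde C)=\{v\}$ for every $\widetilde C\in\mathfrak{C}(C)$.
   Context: A solution of \textsc{Stars NWS} is a spanning subgraph $G'=(V,E')$, $E'\subseteq E$, $|E'|\le\ell$, $\omega(E')\le b$, such that for each $C\in\mathcal{C}$ the set $\mathrm{univ}_{G'}(C)$ of vertices $u\in C$ adjacent in $G'$ to all of $C\setminus\{u\}$ is nonempty; a minimum solution has the minimum number of edges. A vertex $v$ is locally universal for $A\subseteq V$ if $\{v,w\}\in E^*$ for all $w\in A\setminus\{v\}$. Two distinct communities $C_1,C_2$ induce a local cycle in $G'$ if there are $c_i\in\mathrm{univ}_{G'}(C_i)$ such that the graph on $C_1\cup C_2$ with edges $\{\{c_i,w\}: w\in C_i\setminus\{c_i\}, i\in\{1,2\}\}$ contains a cycle; these cycles are local cycles of $G'$. A minimum solution $G'$ is fitting for $E^*$ if $E^*\subseteq E(G')$ and every local cycle of $G'$ uses only edges of $E^*$. Let $G_{\mathfrak{C}}$ be the auxiliary graph with vertex set $\mathcal{C}$ in which distinct $C,D$ are adjacent iff $|C\cap D|\ge 3$ and no vertex of $C\cup D$ is locally universal for $C\cap D$; $\mathfrak{C}(C)$ denotes the set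 of communities in the connected component of $G_{\mathfrak{C}}$ containing $C$. *)

(* Defs.v *)
From mathcomp Require Import all_boot all_order all_algebra.

Set Implicit Arguments.
Unset Strict Implicit.
Unset Printing Implicit Defensive.

Import Order.TTheory GRing.Theory Num.Theory.

(* An undirected edge {v, w} is the two-element set [set v; w]. A spanning
   subgraph (V, F) is represented by its edge set F : {set {set V}}. *)

(* Only the values of [weight] on [edges] matter. *)
Record starsNWS (V : finType) (R : realDomainType) := StarsNWS {
  edges : {set {set V}};
  edges_simple : forall e, e \in edges -> #|e| = 2;
  communities : {set {set V}};
  weight : {set V} -> R;
  max_edges : nat;
  budget : R
}.

Section Graphs.
Variable V : finType.
Implicit Types (F Estar : {set {set V}}) (A C D : {set V}) (p : seq V).

Definition univ F C : {set V} :=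
  [set u in C | [forall w in C :\ u, [set u; w] \in F]].

Definition locally_universal Estar A (v : V) : bool :=
  [forall w in A :\ v, [set v; w] \in Estar].

Definition star (c : V) C : {set {set V}} := [set [set c; w] | w in C :\ c].

Definition is_cycle F p : bool :=
  [&& 2 < size p, uniq p & cycle (fun x y => [set x; y] \in F) p].

Definition cycle_edges p : {set {set V}} := [set [set x; next p x] | x in p].

End Graphs.

Section Problem.
Variables (V : finType) (R : realDomainType) (I : starsNWS V R).
Implicit Types (F Estar : {set {set V}}) (C D : {set V}) (p : seq V).

Definition solution F : Prop :=
  [/\ F \subset edges I,
      #|F| <= max_edges I,
      (\sum_(e in F) weight I e <= budget I)%R &
      forall C, C \in communities I -> univ F C != set0].

Definition minimum_solution F : Prop :=
  solution F /\ forall F', solution F' -> #|F| <= #|F'|.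

Definition local_cycle F p : Prop :=
  exists C1 C2 c1 c2,
    [/\ C1 \in communities I, C2 \in communities I & C1 != C2] /\
    [/\ c1 \in univ F C1, c2 \in univ F C2 &
        is_cycle (star c1 C1 :|: star c2 C2) p].

Definition fitting Estar F : Prop :=
  Estar \subset F /\
  forall p, local_cycle F p -> cycle_edges p \subset Estar.

Definition aux_adj Estar : rel {set V} := fun C D =>
  [&& C \in communities I, D \in communities I, C != D, 3 <= #|C :&: D| &
      [forall v in C :|: D, ~~ locally_universal Estar (C :&: D) v]].

Definition aux_component Estar C : {set {set V}} :=
  [set D in communities I | connect (aux_adj Estar) C D].

End Problem.

(* Main.v *)
(** Let C, D be adjacent in the auxiliary graph, with c universal for C and d
    universal for D. If c <> d, every w in (C :&: D) :\ c lies with c on a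
    cycle c, w, ... of length 3 or 4 in the union of the stars of c and d. This
    is a local cycle, so {c, w} is in Estar and c is locally universal for
    C :&: D, a contradiction. Hence adjacent communities have the same, unique,
    universal vertex, and this propagates along paths. *)
Require Import Defs.
From mathcomp Require Import all_boot all_order all_algebra.

Section Graphs.
Set Implicit Arguments.
Unset Strict Implicit.
Variable V : finType.
Implicit Types (F : {set {set V}}) (C D : {set V}).

Lemma mem_starl (c w : V) C : w \in C -> w != c -> [set c; w] \in star c C.
Proof. by move=> wC wc; apply/imsetP; exists w; rewrite // !inE wc. Qed.

Lemma mem_starr (c w : V) C : w \in C -> w != c -> [set w; c] \in star c C.
Proof. by rewrite setUC; apply: mem_starl. Qed.

Lemma is_cycle_triangle F x y z :
    x != y -> x != z -> y != z -> [set x; y] \in F -> [set y; z] \in F ->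
  [set z; x] \in F -> is_cycle F [:: x; y; z].
Proof.
by move=> xy xz yz Fxy Fyz Fzx; rewrite /is_cycle /= !inE negb_or xy xz yz Fxy Fyz Fzx.
Qed.

Lemma cycle_edges_head (x y : V) p : [set x; y] \in cycle_edges [:: x, y & p].
Proof. by apply/imsetP; exists x; rewrite ?mem_head //= eqxx. Qed.

(** The case split depends on where [d] lies, since an edge of the star of [c] can reach [d] only
    when [d] is in [C]. The cycle is listed from [c, w] so that [cycle_edges_head] applies to the
    edge between them. *)
Lemma star_cycle (c d w : V) C D :
    c != d -> 3 <= #|C :&: D| -> w \in C :&: D -> w != c ->
  exists p, is_cycle (star c C :|: star d D) [:: c, w & p].
Proof.
move=> cd A3 /[dup] wA /setIP[wC wD] wc; have dc : d != c by rewrite eq_sym.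
have cw : c != w by rewrite eq_sym.
(* Removing [c] and [w] from at least three common vertices leaves a third one. *)
have [w' w'A /andP[w'c w'w]] :
    exists2 w', w' \in C :&: D & (w' != c) && (w' != w).
  have /card_gt0P[w'] : 0 < #|(C :&: D) :\: [set c; w]|.
    rewrite cardsD subn_gt0; apply: leq_trans A3; rewrite ltnS.
    by rewrite (leq_trans (subset_leq_card (subsetIr _ _))) // cards2; case: (_ != _).
  by rewrite inE !inE negb_or => /andP[? ?]; exists w'; rewrite ?inE.
have /setIP[w'C w'D] := w'A; have cw' : c != w' by rewrite eq_sym.
(* If [w = d], the triangle is [c, d, w']. *)
have [ew|wd] := eqVneq w d.
  rewrite ew in w'w *; rewrite ew in wC; exists [:: w'].
  have dw' : d != w' by rewrite eq_sym.
  apply: is_cycle_triangle => //; apply/setUP.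
  - by left; apply: mem_starl.
  - by right; apply: mem_starl.
  - by left; apply: mem_starr.
(* If [d] is another common vertex, the star of [c] closes the triangle [c, w, d]. *)
have [dA|dA] := boolP (d \in C :&: D).
  have /setIP[dC dD] := dA; exists [:: d].
  apply: is_cycle_triangle => //; apply/setUP.
  - by left; apply: mem_starl.
  - by right; apply: mem_starr.
  - by left; apply: mem_starr.
(* Otherwise both centres are joined to [w] and [w'], giving the 4-cycle [c, w, d, w']. *)
have w'd : w' != d by apply: contraNneq dA => <-.
have dw' : d != w' by rewrite eq_sym.
have ww' : w != w' by rewrite eq_sym.
exists [:: d; w']; rewrite /is_cycle /= !in_cons !in_nil !orbF !negb_or.
rewrite cw cd cw' wd ww' dw' !in_setU (@mem_starl c w) // (@mem_starr d w) //.
by rewrite (@mem_starl d w') // (@mem_starr c w') // !orbT.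
Qed.

End Graphs.

Section Problem.
Set Implicit Arguments.
Unset Strict Implicit.
Variables (V : finType) (R : realDomainType) (I : starsNWS V R).
Implicit Types (F Estar : {set {set V}}) (C D : {set V}).

Lemma aux_adj_univ_eq Estar F C D c d :
    fitting I Estar F -> aux_adj I Estar C D ->
  c \in univ F C -> d \in univ F D -> c = d.
Proof.
move=> [_ fitF] /and5P[CI DI CD A3 /forall_inP noLU] cU dU.
apply: contraTeq isT => cd; have cC : c \in C by case/setIdP: cU.
(* It remains to contradict [noLU] at [c]. *)
have /negP[] := noLU c (subsetP (subsetUl _ _) _ cC).
apply/forall_inP => w /setD1P[wc wA].
have [p p_cycle] := star_cycle cd A3 wA wc.
apply: (subsetP (fitF [:: c, w & p] _)); last exact: cycle_edges_head.
by exists C, D, c, d.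
Qed.

(** Every element of one set equals every element of the other, and a solution makes both
    nonempty. *)
Lemma aux_adj_univ1 Estar F C D :
    solution I F -> fitting I Estar F -> aux_adj I Estar C D ->
  exists v, univ F C = [set v] /\ univ F D = [set v].
Proof.
move=> [_ _ _ univ_neq0] fitF adjCD; have [CI DI _ _ _] := and5P adjCD.
have [/set0Pn[c cU] /set0Pn[d dU]] := (univ_neq0 C CI, univ_neq0 D DI).
have eq_univ := aux_adj_univ_eq fitF adjCD.
exists c; split; apply/setP => x; rewrite inE; apply/idP/eqP => [xU|->] //.
- by rewrite (eq_univ _ _ xU dU) (eq_univ _ _ cU dU).
- by rewrite (eq_univ _ _ cU xU).
- by rewrite (eq_univ _ _ cU dU).
Qed.

(** Equality of sets, unlike a common singleton, also holds for the empty path, where the induction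
    starts. *)
Lemma connect_aux_adj_univ Estar F C D :
    solution I F -> fitting I Estar F -> connect (aux_adj I Estar) C D ->
  univ F C = univ F D.
Proof.
move=> solF fitF /connectP[p]; elim: p C => [|B p IHp] C /=; first by move=> _ ->.
move=> /andP[adjCB pathp] eqD; rewrite -(IHp B) //.
by have [v [-> ->]] := aux_adj_univ1 solF fitF adjCB.
Qed.

End Problem.

Theorem corollary13 (V : finType) (R : realDomainType) (I : starsNWS V R)
    (Estar : {set {set V}}) (hEstar : Estar \subset edges I)
    (C : {set V}) (hC : C \in communities I)
    (hcomp : 2 <= #|aux_component I Estar C|)
    (F : {set {set V}}) (hmin : minimum_solution I F)
    (hfit : fitting I Estar F) :
  exists v : V,
    v \in \bigcap_(D in aux_component I Estar C) D /\
    forall D : {set V}, D \in aux_component I Estar C -> univ F D = [set v].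
Proof.
have [solF _] := hmin.
(* A path from [C] to another member of its component is nonempty; its first step gives [B], which
   forces [univ F C] to be a singleton. *)
have [B adjCB] : exists B, aux_adj I Estar C B.
  have [D1 [D2 [D1C D2C neqD]]] := card_gt1P hcomp.
  have [D DC neqDC] : exists2 D, D \in aux_component I Estar C & D != C.
    have [eqD1|] := eqVneq D1 C; last by exists D1.
    by exists D2; rewrite // -eqD1 eq_sym.
  case/setIdP: DC => _ /connectP[[|B p] /= pathp eqD].
    by rewrite eqD eqxx in neqDC.
  by exists B; case/andP: pathp.
have [v [univC _]] := aux_adj_univ1 solF hfit adjCB.
have univD D : D \in aux_component I Estar C -> univ F D = [set v].
  case/setIdP=> _ connCD.
  by rewrite -(connect_aux_adj_univ solF hfit connCD).
(* Universal vertices of [D] lie in [D], so [v] is in every member. *)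
exists v; split=> //; apply/bigcapP => D /univD univDv.
by have := set11 v; rewrite -univDv => /setIdP[].
Qed.
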